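(* $R(B_4, B_5)\geq 18$, where $R$ denotes the two-color Ramsey number and $B_n$ denotes the book graph $K_2+\overline{K_n}$ with $n$ triangular pages.
   Context: All graphs are finite, simple and undirected. For graphs $G_1, G_2$, the two-color Ramsey number $R(G_1,G_2)$ is the least integer $n$ such that for any edge-coloring of the complete graph $K_n$ with 2 colors there exists some $i\in\{1,2\}$ such that the subgraph of $K_n$ formed by the edges of color $i$ contains a copy of $G_i$ as a (not necessarily induced) subgraph. For two graphs $G$ and $H$, the join $G+H$ is the graph obtained from the disjoint union of $G$ and $H$ by adding all the edges between a vertex of $G$ and a vertex of $H$. The book $B_n$ is the join $K_2+\overline{K_n}$, where $\overline{K_n}$ is the empty (edgeless) graph on $n$ vertices; it has $n+2$ vertices and consists of $n$ triangles sharing a common edge. *)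

(* Defs.v *)
From mathcomp Require Import all_boot.

Set Implicit Arguments.
Unset Strict Implicit.
Unset Printing Implicit Defensive.

Record sgraph := SGraph {
  vertex :> finType;
  edge : rel vertex;
  edge_sym : symmetric edge;
  edge_irrefl : irreflexive edge }.

Definition complete_rel n : rel 'I_n := fun x y => x != y.

Lemma complete_sym n : symmetric (@complete_rel n).
Proof. by move=> x y; rewrite /complete_rel eq_sym. Qed.

Lemma complete_irrefl n : irreflexive (@complete_rel n).
Proof. by move=> x; rewrite /complete_rel eqxx. Qed.

Definition complete n := SGraph (@complete_sym n) (@complete_irrefl n).

Definition edgeless_rel n : rel 'I_n := fun _ _ => false.

Lemma edgeless_sym n : symmetric (@edgeless_rel n).
Proof. by []. Qed.

Lemma edgeless_irrefl n : irreflexive (@edgeless_rel n).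
Proof. by []. Qed.

Definition edgeless n := SGraph (@edgeless_sym n) (@edgeless_irrefl n).

Definition join_rel (G H : sgraph) : rel (G + H)%type := fun u v =>
  match u, v with
  | inl x, inl y => edge x y
  | inr x, inr y => edge x y
  | _, _ => true
  end.

Lemma join_sym G H : symmetric (@join_rel G H).
Proof. by move=> [x|x] [y|y] //=; apply: edge_sym. Qed.

Lemma join_irrefl G H : irreflexive (@join_rel G H).
Proof. by move=> [x|x] /=; apply: edge_irrefl. Qed.

Definition join G H := SGraph (@join_sym G H) (@join_irrefl G H).

Definition book n := join (complete 2) (edgeless n).

(* Not necessarily induced: non-edges of G are unconstrained. *)
Definition contains_copy (H G : sgraph) : bool :=
  [exists f : {ffun G -> H},
    injectiveb f && [forall x, forall y, edge x y ==> edge (f x) (f y)]].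

(* The edge xy is the two-element set [set x; y]; the values of a colouring on
   sets that are not edges are never used. *)
Definition coloring (G : sgraph) := {ffun {set G} -> bool}.

Definition color_rel (G : sgraph) (c : coloring G) (i : bool) : rel G :=
  fun x y => edge x y && (c [set x; y] == i).

Lemma color_sym G (c : coloring G) i : symmetric (color_rel c i).
Proof. by move=> x y; rewrite /color_rel edge_sym setUC. Qed.

Lemma color_irrefl G (c : coloring G) i : irreflexive (color_rel c i).
Proof. by move=> x; rewrite /color_rel edge_irrefl. Qed.

Definition color_class (G : sgraph) (c : coloring G) (i : bool) :=
  SGraph (color_sym c i) (color_irrefl c i).

Definition arrows (G1 G2 : sgraph) (n : nat) : bool :=
  [forall c : coloring (complete n),
    contains_copy (color_class c true) G1
    || contains_copy (color_class c false) G2].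

Lemma ramsey_sets (T : finType) (e : rel T) (e_sym : symmetric e) s t
    (A : {set T}) :
  2 ^ (s + t) <= #|A| ->
  (exists S : {set T}, [/\ S \subset A, #|S| = s &
     {in S &, forall x y, x != y -> e x y}])
  \/ (exists S : {set T}, [/\ S \subset A, #|S| = t &
     {in S &, forall x y, x != y -> ~~ e x y}]).
Proof.
have extend (p : bool) k x (B : {set T}) :
    x \in B ->
    (exists S : {set T}, [/\ S \subset [set y in B :\ x | e x y == p],
       #|S| = k & {in S &, forall x y, x != y -> e x y == p}]) ->
    exists S : {set T}, [/\ S \subset B, #|S| = k.+1 &
      {in S &, forall x y, x != y -> e x y == p}].
  move=> xB [S [/subsetP sSB cardS Sp]].
  have SB y : y \in S -> [/\ y != x, y \in B & e x y == p].
    by move=> /sSB; rewrite !inE => /andP[/andP[]].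
  exists (x |: S); split.
  - by apply/subsetP=> y /setU1P[-> // | /SB[]].
  - by rewrite cardsU1 cardS; case: (boolP (x \in S)) => [/SB[]|]; rewrite ?eqxx.
  - move=> y z /setU1P[->|yS] /setU1P[->|zS]; rewrite ?eqxx //.
    + by case: (SB _ zS).
    + by rewrite e_sym; case: (SB _ yS).
    + exact: Sp.
suff main k : forall s t (A : {set T}), s + t = k -> 2 ^ k <= #|A| ->
    (exists S : {set T}, [/\ S \subset A, #|S| = s &
       {in S &, forall x y, x != y -> e x y == true}])
    \/ (exists S : {set T}, [/\ S \subset A, #|S| = t &
       {in S &, forall x y, x != y -> e x y == false}]).
  move=> /main-/(_ s t erefl)[] [S [SA cS Sp]]; [left|right]; exists S; split=> // x y xS yS xy.
    by rewrite (eqP (Sp _ _ xS yS xy)).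
  by rewrite (eqP (Sp _ _ xS yS xy)).
elim: k => [|k IHk] {}s {}t {}A.
  move=> /eqP; rewrite addn_eq0 => /andP[/eqP-> _] _; left; exists set0.
  by rewrite sub0set cards0; split=> // x y; rewrite inE.
case: s => [|s]; first by move=> *; left; exists set0; rewrite sub0set cards0; split=> // x y; rewrite inE.
case: t => [|t]; first by move=> *; right; exists set0; rewrite sub0set cards0; split=> // x y; rewrite inE.
move=> stk leA.
have /card_gt0P[x xA] : 0 < #|A| by apply: leq_trans leA; rewrite expn_gt0.
pose N p := [set y in A :\ x | e x y == p].
have cardN : #|A| = (#|N true| + #|N false|).+1.
  rewrite (cardsD1 x) xA -(cardsID (N true) (A :\ x)) add1n; congr (_ + _).+1.
    by apply: eq_card => y; rewrite !inE; case: (y == x) (y \in A) (e x y) => [] [] [].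
  by apply: eq_card => y; rewrite !inE; case: (y == x) (y \in A) (e x y) => [] [] [].
have [leN|] := leqP (2 ^ k) #|N true|.
  case: (IHk s t.+1 (N true)) => //; first by case: stk.
    by move=> /(extend _ _ _ _ xA); left.
  move=> [S [SA cS Sp]]; right; exists S; split=> //.
  by apply: subset_trans SA _; apply/subsetP=> y; rewrite !inE => /andP[/andP[]].
move=> ltN; have leN : 2 ^ k <= #|N false|.
  move: leA; rewrite cardN expnS mul2n -addnn -addSn => leA.
  by rewrite -(leq_add2l (2 ^ k)) (leq_trans leA) // leq_add2r.
case: (IHk s.+1 t (N false)) => //; first by case: stk; rewrite addnS addSn.
  move=> [S [SA cS Sp]]; left; exists S; split=> //.
  by apply: subset_trans SA _; apply/subsetP=> y; rewrite !inE => /andP[/andP[]].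
by move=> /(extend _ _ _ _ xA); right.
Qed.

Lemma clique_contains_copy (G H : sgraph) (S : {set H}) :
  #|S| = #|G| -> {in S &, forall x y, x != y -> edge x y} ->
  contains_copy H G.
Proof.
move=> cardS Sclique.
pose g (x : G) := enum_val (cast_ord (esym cardS) (enum_rank x)).
have g_inj : injective g.
  by move=> x y /enum_val_inj/cast_ord_inj/enum_rank_inj.
apply/existsP; exists [ffun x => g x]; apply/andP; split.
  by apply/injectiveP=> x y; rewrite !ffunE => /g_inj.
apply/forallP=> x; apply/forallP=> y; apply/implyP=> xy; rewrite !ffunE.
apply: Sclique; rewrite ?enum_valP // (inj_eq g_inj).
by apply: contraTneq xy => ->; rewrite edge_irrefl.
Qed.

Lemma ramsey_ex (G1 G2 : sgraph) : exists n, arrows G1 G2 n.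
Proof.
exists (2 ^ (#|G1| + #|G2|)); apply/forallP=> c.
pose e x y := c [set x; y].
have e_sym : symmetric e by move=> x y; rewrite /e setUC.
case: (@ramsey_sets _ e e_sym #|G1| #|G2| setT); first by rewrite cardsT card_ord.
  move=> [S [_ cS Sp]]; apply/orP; left; apply: (@clique_contains_copy _ (color_class c true) S) => //.
  move=> x y xS yS xy; rewrite /= /color_rel /= /complete_rel xy.
  by move: (Sp _ _ xS yS xy); rewrite /e => ->.
move=> [S [_ cS Sp]]; apply/orP; right; apply: (@clique_contains_copy _ (color_class c false) S) => //.
move=> x y xS yS xy; rewrite /= /color_rel /= /complete_rel xy.
by move: (Sp _ _ xS yS xy); rewrite /e => /negbTE->.
Qed.

Definition ramsey (G1 G2 : sgraph) : nat := ex_minn (ramsey_ex G1 G2).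

(* Main.v *)
(** The Paley colouring of [K_17] colours the edge [xy] according to whether
    [x - y] is a nonzero square modulo 17. The Paley graph is self-complementary
    and strongly regular with parameters (17, 8, 3, 4), so the endpoints of every
    edge have only three common neighbours in the colour of that edge, and
    neither colour contains even a copy of [B_4]. *)

Require Import Defs.
From mathcomp Require Import all_boot.

(** The spine of the book maps to the edge [x y], and its [n] pages inject into the common
    neighbourhood. *)
Lemma book_common_neighbours (G : sgraph) n :
  contains_copy G (book n) ->
  exists x y : G, edge x y /\ n <= #|[set z | edge x z && edge y z]|.
Proof.
case/existsP=> f /andP[/injectiveP f_inj /forallP f_edge].
have edge_f u v : edge u v -> edge (f u) (f v).
  by move: (f_edge u) => /forallP/(_ v)/implyP.
exists (f (inl ord0)), (f (inl ord_max)); split; first exact: edge_f.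
have page_inj : injective (fun k : 'I_n => f (inr k)) by move=> k l /f_inj[].
rewrite -[leqLHS]card_ord -(card_imset predT page_inj).
apply/subset_leq_card/subsetP=> _ /imsetP[k _ ->].
by rewrite inE !edge_f.
Qed.

(* The list consists of the nonzero squares modulo 17; [x + 17 - y] avoids
   truncation for [y < 17]. *)
Definition paley17 (x y : nat) : bool :=
  (x + 17 - y) %% 17 \in [:: 1; 2; 4; 8; 9; 13; 15; 16].

(** Symmetry reflects that -1, that is 16, is a square modulo 17. *)
Lemma paley17_sym x y : x < 17 -> y < 17 -> paley17 x y = paley17 y x.
Proof.
have sym : all (fun x => all (fun y => paley17 x y == paley17 y x) (iota 0 17))
               (iota 0 17) by vm_compute.
move=> ltx lty; apply/eqP.
by apply: (allP (allP sym x _)); rewrite mem_iota.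
Qed.

Lemma paley17_irrefl x : paley17 x x = false.
Proof. by rewrite /paley17 addKn modnn. Qed.

(** For [i = false] the conjunct [x != y] excludes loops. *)
Definition paley17_edge (i : bool) (x y : nat) : bool :=
  (x != y) && (paley17 x y == i).

Lemma paley17_common_neighbours i x y : x < 17 -> y < 17 ->
  paley17_edge i x y ->
  count (fun z => paley17_edge i x z && paley17_edge i y z) (iota 0 17) <= 3.
Proof.
have bound : all (fun x => all (fun y => paley17_edge i x y ==>
    (count (fun z => paley17_edge i x z && paley17_edge i y z) (iota 0 17) <= 3))
  (iota 0 17)) (iota 0 17) by case: i; vm_compute.
move=> ltx lty; apply/implyP.
by apply: (allP (allP bound x _)); rewrite mem_iota.
Qed.

(** Edges are unordered pairs, so either order is tried. For [m <= 17] this restricts the Paley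
    colouring to [m] vertices. *)
Definition paley17_coloring m : coloring (complete m) :=
  [ffun S : {set 'I_m} => [exists x in S, exists y in S, paley17 x y]].

Lemma paley17_coloringE m (i : bool) (x y : color_class (paley17_coloring m) i) :
  m <= 17 -> edge x y = paley17_edge i (x : 'I_m) (y : 'I_m).
Proof.
move: x y => /= x y le_m; rewrite /color_rel /= /complete_rel ffunE.
congr (_ && (_ == i)).
have lt17 (z : 'I_m) : z < 17 := leq_trans (ltn_ord z) le_m.
apply/exists_inP/idP=> [[u uS /exists_inP[v vS]]|xy]; last first.
  by exists x; rewrite ?set21 //; apply/exists_inP; exists y; rewrite ?set22.
by case/set2P: uS => ->; case/set2P: vS => ->;
  rewrite ?paley17_irrefl // paley17_sym.
Qed.

Lemma paley17_coloring_book m n i : m <= 17 -> 3 < n ->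
  contains_copy (color_class (paley17_coloring m) i) (book n) = false.
Proof.
move=> le_m lt3n; apply/negbTE/negP=> /book_common_neighbours[x [y [xy]]].
have lt17 (z : 'I_m) : z < 17 := leq_trans (ltn_ord z) le_m.
rewrite paley17_coloringE // in xy.
apply/negP; rewrite -ltnNge; apply: leq_ltn_trans lt3n.
apply: leq_trans (paley17_common_neighbours _ _ _ (lt17 x) (lt17 y) xy).
(* Read as numbers, the common neighbours in ['I_m] form a duplicate-free sublist of those in
   [iota 0 17]. *)
rewrite -size_filter cardE -(size_map (val : 'I_m -> nat)).
apply: uniq_leq_size; first by rewrite (map_inj_uniq val_inj) enum_uniq.
move=> _ /mapP[z z_common ->].
move: z_common; rewrite mem_enum inE !paley17_coloringE // => z_common.
by rewrite mem_filter z_common mem_iota lt17.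
Qed.

Theorem theorem3p4 : 18 <= ramsey (book 4) (book 5).
Proof.
rewrite /ramsey; case: ex_minnP => m arrows_m _.
rewrite ltnNge; apply/negP=> le_m.
have /forallP/(_ (paley17_coloring m)) := arrows_m.
by rewrite !paley17_coloring_book.
Qed.
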